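(* Let $q\ge 4$ be a power of two, let $n\ge 6$ be an integer, and let $t=\lceil\log_2 n\rceil$. Put $$k=(n-3t+3)\log_2 q+(t-3)(2\log_2 q-1)+(\log_2 q-1)=n\log_2 q-t(\log_2 q+1)-2(\log_2 q-1).$$ Then for every integer $a$ with $0\le a\le n-1$ and every $b\in\mathbb{Z}_q$ there is a systematic encoder $E_{a,b}:\{0,1\}^k\to\mathcal{VT}_{a,b}(n)$ mapping $k$-bit messages to codewords of $\mathcal{VT}_{a,b}(n)$. Moreover, for fixed $q$, these encoders can be computed by an algorithm which, on input $n,a,b$ and a message $M\in\{0,1\}^k$, outputs $E_{a,b}(M)$ in time $O(n)$. In particular the rate of the encoder is $$\frac kn=\log_2 q-\frac{\lceil\log_2 n\rceil(\log_2 q+1)}{n}-\frac{2\log_2 q-2}{n}\ \text{ bits/symbol}.$$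
   Context: $\mathbb{Z}_q=\{0,1,\dots,q-1\}$ is the ring of integers modulo $q$, with its elements ordered naturally $0<1<\dots<q-1$. For a sequence $S=s_0s_1\cdots s_{n-1}\in\mathbb{Z}_q^n$, the auxiliary binary sequence $A_S=\alpha_1\alpha_2\cdots\alpha_{n-1}$ of length $n-1$ is defined by $\alpha_i=1$ if $s_i\ge s_{i-1}$ and $\alpha_i=0$ if $s_i<s_{i-1}$, for $1\le i\le n-1$. Its VT syndrome is $\mathsf{syn}(A_S)=\sum_{i=1}^{n-1} i\,\alpha_i \bmod n$, an element of $\{0,\dots,n-1\}$. The modular sum is $\mathsf{sum}(S)=\sum_{i=0}^{n-1}s_i \bmod q$. For $0\le a\le n-1$ and $b\in\mathbb{Z}_q$, the $q$-ary Varshamov–Tenengolts code of length $n$ with parameters $(a,b)$ is $$\mathcal{VT}_{a,b}(n)=\{S\in\mathbb{Z}_q^n:\ \mathsf{syn}(A_S)=a,\ \mathsf{sum}(S)=b\}.$$ Systematic encoder: the message bits are assigned to pre-specified positions of the codeword. Precisely, for given $n,q$ there are a set of positions $P\subseteq\{0,\dots,n-1\}$ and an injective map $f:\{0,1\}^k\to\mathbb{Z}_q^P$, both independent of $a$, $b$ and the message, such that for all $a,b$ and all $M\in\{0,1\}^k$ the restriction of $E_{a,b}(M)$ to the positions in $P$ equals $f(M)$. (In particular each $E_{a,b}$ is injective.) Time is measured by the number of elementary operations (arithmetic and comparison on integers of $O(\log n)$ bits, memory access), with the constant in $O(n)$ allowed to depend on $q$. *)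

(* Defs.v *)
From mathcomp Require Import all_boot all_order all_algebra.
Set Implicit Arguments.
Unset Strict Implicit.
Unset Printing Implicit Defensive.

(* A sequence of length [n] over the integers modulo [q] is an
   [n.-tuple 'Z_q].  The type ['Z_q] is the ring of integers modulo [q] only
   when [1 < q].  Its elements coerce to their representatives in
   [{0, ..., q-1}], and the natural order is the order of representatives. *)

(* The bit alpha_i of the auxiliary sequence, meaningful for 1 <= i <= n-1. *)
Definition alpha (q n : nat) (S : n.-tuple 'Z_q) (i : nat) : bool :=
  (nth 0%R S i.-1 : nat) <= (nth 0%R S i : nat).

Definition syn (q n : nat) (S : n.-tuple 'Z_q) : nat :=
  (\sum_(1 <= i < n) i * alpha S i) %% n.

Definition modsum (q n : nat) (S : n.-tuple 'Z_q) : 'Z_q :=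
  (\sum_(i < n) tnth S i)%R.

Definition VT (q n : nat) (a : 'I_n) (b : 'Z_q) : {set n.-tuple 'Z_q} :=
  [set S : n.-tuple 'Z_q | (syn S == a) && (modsum S == b)].

(* [q] is meant to be a power of two, so [trunc_log 2 q] is its exact
   logarithm; [up_log 2 n] is the ceiling of the base 2 logarithm of [n].  For
   [6 <= n] and [4 <= q] none of the subtractions below is truncated. *)
Definition lg (q : nat) : nat := trunc_log 2 q.
Definition clg (n : nat) : nat := up_log 2 n.

Definition msg_len (q n : nat) : nat :=
  (n + 3 - 3 * clg n) * lg q + (clg n - 3) * (2 * lg q - 1) + (lg q - 1).

Definition restrict (q n : nat) (P : {set 'I_n}) (S : n.-tuple 'Z_q) :
    {ffun {i : 'I_n | i \in P} -> 'Z_q} :=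
  [ffun i => tnth S (val i)].

Definition encoders (q n : nat) : Type :=
  'I_n -> 'Z_q -> (msg_len q n).-tuple bool -> n.-tuple 'Z_q.

(* The positions [P] and the assignment [f] depend on [q] and [n] only. *)
Definition systematic (q n : nat) (E : encoders q n) : Prop :=
  exists (P : {set 'I_n})
         (f : (msg_len q n).-tuple bool ->
              {ffun {i : 'I_n | i \in P} -> 'Z_q}),
    injective f /\
    forall (a : 'I_n) (b : 'Z_q) (M : (msg_len q n).-tuple bool),
      restrict P (E a b M) = f M.

(* A unit-cost random access machine.  Programs are finite texts of a
   structured language over natural-number registers and finitely many
   (statically named) memory arrays.  Each constant, register access, memory
   access, arithmetic operation, comparison, assignment and branching counts as
   one elementary operation, and every value that occurs must be at most the
   word bound [W]. *)

Inductive binop := Add | Sub | Mul | Div | Mod | Leq | Ltn | Eqn.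

(* Subtraction is truncated, division by 0 gives 0, [m] modulo 0 is [m], and
   comparisons return 0 or 1. *)
Definition eval_binop (o : binop) (x y : nat) : nat :=
  match o with
  | Add => x + y
  | Sub => x - y
  | Mul => x * y
  | Div => x %/ y
  | Mod => x %% y
  | Leq => x <= y
  | Ltn => x < y
  | Eqn => x == y
  end.

Inductive expr :=
  | Lit of nat
  | Reg of nat
  | Get of nat & expr              (* [Get m e]: cell number [e] of array [m] *)
  | Bin of binop & expr & expr.

Inductive cmd :=
  | Skip
  | Assign of nat & expr
  | Put of nat & expr & expr       (* [Put m e1 e2]: cell [e1] of [m] := [e2] *)
  | Seq of cmd & cmd
  | If of expr & cmd & cmd         (* nonzero values are true *)
  | While of expr & cmd.

Record state := State { reg : nat -> nat; mem : nat -> nat -> nat }.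

Definition set_reg (s : state) (x v : nat) : state :=
  State (fun y => if y == x then v else reg s y) (mem s).

Definition set_mem (s : state) (m i v : nat) : state :=
  State (reg s)
    (fun m' j => if (m' == m) && (j == i) then v else mem s m' j).

Fixpoint eval (s : state) (e : expr) : nat :=
  match e with
  | Lit c => c
  | Reg x => reg s x
  | Get m e1 => mem s m (eval s e1)
  | Bin o e1 e2 => eval_binop o (eval s e1) (eval s e2)
  end.

(* The values of all subexpressions, hence also all addresses, are at most
   [W]. *)
Fixpoint fits (W : nat) (s : state) (e : expr) : bool :=
  (eval s e <= W) &&
  match e with
  | Lit _ | Reg _ => true
  | Get _ e1 => fits W s e1
  | Bin _ e1 e2 => fits W s e1 && fits W s e2
  end.

Fixpoint cost (e : expr) : nat :=
  match e with
  | Lit _ | Reg _ => 1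
  | Get _ e1 => (cost e1).+1
  | Bin _ e1 e2 => (cost e1 + cost e2).+1
  end.

(* [exec W c s T s']: started in [s], the program [c] stops in [s'] after
   exactly [T] elementary operations, all values being at most [W].  Execution
   is deterministic; a program that exceeds [W] or runs forever is not related
   to any final state. *)
Inductive exec (W : nat) : cmd -> state -> nat -> state -> Prop :=
  | ExecSkip s : exec W Skip s 1 s
  | ExecAssign x e s :
      fits W s e ->
      exec W (Assign x e) s (cost e).+1 (set_reg s x (eval s e))
  | ExecPut m e1 e2 s :
      fits W s e1 -> fits W s e2 ->
      exec W (Put m e1 e2) s (cost e1 + cost e2).+1
           (set_mem s m (eval s e1) (eval s e2))
  | ExecSeq c1 c2 s1 s2 s3 T1 T2 :
      exec W c1 s1 T1 s2 -> exec W c2 s2 T2 s3 ->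
      exec W (Seq c1 c2) s1 (T1 + T2) s3
  | ExecIfTrue e c1 c2 s s' T :
      fits W s e -> eval s e != 0 -> exec W c1 s T s' ->
      exec W (If e c1 c2) s (cost e + T).+1 s'
  | ExecIfFalse e c1 c2 s s' T :
      fits W s e -> eval s e = 0 -> exec W c2 s T s' ->
      exec W (If e c1 c2) s (cost e + T).+1 s'
  | ExecWhileTrue e c s1 s2 s3 T1 T2 :
      fits W s1 e -> eval s1 e != 0 ->
      exec W c s1 T1 s2 -> exec W (While e c) s2 T2 s3 ->
      exec W (While e c) s1 (cost e + T1 + T2).+1 s3
  | ExecWhileFalse e c s :
      fits W s e -> eval s e = 0 ->
      exec W (While e c) s (cost e).+1 s.

(* Input: registers 0, 1, 2 hold [n], [a], [b] and array 0 holds the message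
   bits; everything else is 0. *)
Definition input (n a b : nat) (M : seq bool) : state :=
  State (fun x => nth 0 [:: n; a; b] x)
        (fun m i => if m == 0 then nat_of_bool (nth false M i) else 0).

(* Output: cells 0, ..., n-1 of array 1. *)
Definition outputs (q n : nat) (s : state) (S : n.-tuple 'Z_q) : Prop :=
  forall i : 'I_n, mem s 1 i = tnth S i :> nat.

(* For fixed [q], one program computes [E n a b M] from [(n, a, b, M)] for all
   [n] at least [n0], with O(n) elementary operations on integers at most
   [n ^ c], that is, of O(log n) bits.  The program and the constants [c] and
   [C] depend on [q] only. *)
Definition linear_time_computable (q n0 : nat)
    (E : forall n : nat, encoders q n) : Prop :=
  exists (p : cmd) (c C : nat),
    forall n : nat, n0 <= n ->
    forall (a : 'I_n) (b : 'Z_q) (M : (msg_len q n).-tuple bool),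
      exists (T : nat) (s : state),
        [/\ exec (n ^ c) p (input n a b M) T s,
            T <= C * n
          & outputs s (E n a b M)].

(* Main.v *)
Require Import Defs.
From mathcomp Require Import all_boot all_order all_algebra zify ring.
From Stdlib Require Import FunctionalExtensionality.
Import GRing.Theory.
Set Implicit Arguments.
Unset Strict Implicit.
Unset Printing Implicit Defensive.

(** The positions 0, 1, 2 and the powers of two are reserved, position 3 always
    holds q - 1, and the message fills the others.  At u = s_(2^j - 1) the
    values 0 and w + 1, with w = s_(2^j + 1), are avoided at the price of one
    bit.  Start with s_(2^j) = u and s_0 = s_1 = s_2 = 0, so that all dyadic
    ascents are present; replacing s_(2^j) by u - 1 removes the ascent at 2^j
    and nothing else.  The excess of the syndrome over a is a number below n,
    hence a sum of distinct powers of two below n, and its binary digits say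
    which ascents to remove.  The ascents at 1 and 2 are left to s_0, s_1, s_2,
    which can realise each of the four ascent patterns with any sum modulo q,
    while s_2 <= s_3 = q - 1 keeps the ascent at 3.  All steps are single
    passes over the positions. *)

(** * Powers of two *)

Definition pow2 (i : nat) : bool := i == 2 ^ up_log 2 i.

Lemma pow2_expn j : pow2 (2 ^ j).
Proof. by rewrite /pow2 up_expnK. Qed.

Lemma pow2_gap i j : pow2 i -> pow2 j -> i < j -> 2 * i <= j.
Proof.
move=> /eqP -> /eqP ->; rewrite ltn_exp2l // -expnS => lt_ij.
by rewrite leq_exp2l.
Qed.

(** This recursion turns sums over powers of two into inductions on [n]. The start fits because
    [up_log 2 0 = 0], so [pow2 0] is false. *)
Lemma up_logS n : up_log 2 n.+1 = up_log 2 n + pow2 n.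
Proof.
rewrite /pow2; case: n => [|[|n]] //.
have /andP[lo hi] := @up_log_bounds 2 n.+2 isT isT.
have [eq_n|neq_n] := eqVneq n.+2 (2 ^ up_log 2 n.+2); last first.
  have := @up_log_gt0 2 n.+2; case: (up_log 2 n.+2) lo hi neq_n => [//|l] lo hi neq_n _.
  rewrite addn0; apply: up_log_eq => //.
  by rewrite (leq_trans lo) //= ltn_neqAle neq_n hi.
rewrite addn1; apply: up_log_eq => //; rewrite -eq_n leqnn expnS -eq_n.
lia.
Qed.

Lemma sum_pow2 n : \sum_(i < n) pow2 i = up_log 2 n.
Proof.
by elim: n => [|n IH]; rewrite ?big_ord0 // big_ord_recr /= IH up_logS.
Qed.

(** When [n] is a power of two the modulus doubles, and the remainder gains [n] times the next
    binary digit of [d]; otherwise nothing changes. *)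
Lemma sum_pow2_digits d n :
  \sum_(i < n) i * (pow2 i * (d %/ i %% 2)) = d %% 2 ^ up_log 2 n.
Proof.
elim: n => [|n IH]; first by rewrite big_ord0 modn1.
rewrite big_ord_recr /= {}IH up_logS.
case pow_n: (pow2 n); last by rewrite mul0n muln0 !addn0.
rewrite addn1 expnS -(eqP pow_n) mul1n.
have n_gt0 : 0 < n by rewrite (eqP pow_n) expn_gt0.
rewrite {3}(divn_eq d n) {2}(divn_eq (d %/ n) 2).
have lt_n := ltn_pmod d n_gt0.
have lt_2 := ltn_pmod (d %/ n) (isT : 0 < 2).
set u := d %/ n %/ 2; set v := d %/ n %% 2; set w := d %% n.
have -> : (u * 2 + v) * n + w = u * (2 * n) + (w + n * v) by lia.
have le_n: n * v <= n by rewrite -{2}(muln1 n) leq_mul2l -ltnS lt_2 orbT.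
rewrite modnMDl modn_small; lia.
Qed.

Lemma up_log2_bound n : 6 <= n -> 3 <= up_log 2 n /\ 3 * up_log 2 n <= n + 3.
Proof.
move=> n_ge6.
have t_ge3: 3 <= up_log 2 n by apply: (@leq_trans (up_log 2 6)); rewrite ?leq_up_log.
split=> //; have := @up_log_gtn 2 n isT ltac:(lia).
case: (up_log 2 n) t_ge3 => [//|[//|[//|[|l]]]] _ /=; first by lia.
(* Here the logarithm is [l + 4], so [n] exceeds [2 ^ (l + 3)], and [3 * l + 9 <= n] is needed. *)
have: 3 * l + 8 <= 2 ^ l.+3 by elim: l => // l; rewrite (expnS 2 l.+3); lia.
lia.
Qed.

(** * Codewords *)

Definition msg_bit (M : seq bool) (r : nat) : nat := nth false M r.

Definition digit (M : seq bool) (p l : nat) : nat :=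
  \sum_(r < l) 2 ^ r * msg_bit M (p + r).

Lemma digitS M p l : digit M p l.+1 = digit M p l + 2 ^ l * msg_bit M (p + l).
Proof. by rewrite /digit big_ord_recr. Qed.

Lemma digit_ub M p l : digit M p l < 2 ^ l.
Proof.
elim: l => [|l IH]; first by rewrite /digit big_ord0.
rewrite digitS expnS mul2n -addnn.
have : msg_bit M (p + l) <= 1 by rewrite /msg_bit leq_b1.
nia.
Qed.

Lemma digit_inj M M' p l : digit M p l = digit M' p l ->
  forall r, p <= r < p + l -> nth false M r = nth false M' r.
Proof.
elim: l => [|l IH] eqM r /andP[pr]; first by rewrite addn0 leqNgt ltnS pr.
have := digit_ub M p l; have := digit_ub M' p l.
move: eqM IH; rewrite !digitS /msg_bit.
move: (digit M p l) (digit M' p l) => u v eq_uv IH ltv ltu.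
have [eqd eqb] : u = v /\ nth false M (p + l) = nth false M' (p + l).
  by move: eq_uv; case: (nth _ _ _); case: (nth _ _ _); lia.
rewrite addnS ltnS leq_eqVlt => /predU1P[-> // | lt_r].
by apply: IH => //; rewrite pr.
Qed.

Section Codeword.

Variables q n : nat.

(** The bound makes position [n] non-dyadic even if [n] is a power of two, so the last symbol is
    then not treated as a left neighbour. *)
Definition dyadic (i : nat) : bool := (i < n) && pow2 i.

(** Tells whether the symbol keeps its top bit. Left neighbours of powers of two pay one bit for
    [avoid]. Position 5 pays because position 3 is fixed: [s_5 < q / 2] keeps [s_3 = q - 1]
    different from [s_5 + 1]. *)
Definition full (i : nat) : nat := (1 - dyadic (i + 1)) * (1 - (i == 5)).
Definition live (i : nat) : nat := (4 < i) * (1 - dyadic i).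
Definition width (i : nat) : nat := live i * (lg q - 1 + full i).
Definition offset (i : nat) : nat := \sum_(j < i) width j.

(* Position 3 holds q - 2, which [avoid] turns into q - 1. *)
Definition raw (M : seq bool) (i : nat) : nat :=
  (i < n) *
  ((i == 3) * (q - 2) + live i * digit M (offset i) (lg q - 1 + full i)).

(* Injective from {0, ..., q/2 - 1} to {1, ..., q - 1} minus w + 1. *)
Definition avoid (x w : nat) : nat := if x == w then q - 1 else x + 1.

(* If n = 2^j + 1, the missing right neighbour s_n is read as 0. *)
Definition base (M : seq bool) (i : nat) : nat :=
  if i < 3 then 0
  else if dyadic i then avoid (raw M (i - 1)) (raw M (i + 1))
  else if dyadic (i + 1) then avoid (raw M i) (raw M (i + 2))
  else raw M i.

Definition ascents (x : nat -> nat) (k : nat) : nat :=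
  \sum_(i < k) i * (x (i - 1) <= x i).

Definition defect (a : nat) (M : seq bool) : nat :=
  (ascents (base M) n + n - a) %% n.

Definition flip (d i : nat) : nat := dyadic i * (d %/ i %% 2).

Definition tail (a : nat) (M : seq bool) (i : nat) : nat :=
  base M i - flip (defect a M) i.

(** The factor [q - 1] acts as minus one modulo [q]. The first three tail values vanish, so the head
    can be chosen afterwards. *)
Definition deficit (a b : nat) (M : seq bool) : nat :=
  (b + (q - 1) * \sum_(i < n) tail a M i) %% q.

(* e1 and e2 tell whether to remove the ascents at 1 and 2; c is the sum. *)
Definition head3 (e1 e2 c : nat) : seq nat :=
  if e1 == 0 then
    if e2 == 0 then [:: 0; 0; c]
    else if c == 0 then [:: 1; q - 1; 0] else [:: 0; c; 0]
  else
    if e2 == 0 then if c == 0 then [:: q - 1; 0; 1] else [:: c; 0; 0]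
    else if c == 0 then [:: q - 1; 1; 0]
    else if c < 3 then [:: q - 1; 2; c - 1] else [:: c - 1; 1; 0].

Definition word (a b : nat) (M : seq bool) (i : nat) : nat :=
  if i < 3 then
    nth 0 (head3 (defect a M %% 2) (defect a M %/ 2 %% 2) (deficit a b M)) i
  else tail a M i.

Hypotheses (q_ge4 : 4 <= q) (q_pow2 : q = 2 ^ lg q) (n_ge6 : 6 <= n).

Let lg_ge2 : 2 <= lg q.
Proof. by rewrite -(@leq_exp2l 2) // -q_pow2. Qed.

(** * Neighbourhoods of the powers of two and ranges of the symbols *)

Lemma dyadic_gap i j : dyadic i -> dyadic j -> i < j -> 2 * i <= j.
Proof. by move=> /andP[_ Di] /andP[_ Dj]; apply: pow2_gap. Qed.

Lemma dyadic1 : dyadic 1. Proof. by rewrite /dyadic (pow2_expn 0) andbT; lia. Qed.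
Lemma dyadic2 : dyadic 2. Proof. by rewrite /dyadic (pow2_expn 1) andbT; lia. Qed.
Lemma dyadic4 : dyadic 4. Proof. by rewrite /dyadic (pow2_expn 2) andbT; lia. Qed.

Lemma dyadic_lt8 i : i < 8 -> dyadic i = (i \in [:: 1; 2; 4]).
Proof.
case: i => [|[|[|[|[|i]]]]] //= lt_i; first by rewrite /dyadic andbF.
- by rewrite dyadic1.
- by rewrite dyadic2.
- by apply/negP=> D3; have := dyadic_gap dyadic2 D3 isT.
- by rewrite dyadic4.
by apply/negP=> Di; have := dyadic_gap dyadic4 Di isT; lia.
Qed.

(** From 4 on, a right neighbour of a power of two is never the left neighbour of the next one, so
    it holds its raw symbol. *)
Lemma dyadic_next i : 2 < i -> dyadic i ->
  [/\ dyadic (i - 1) = false, dyadic (i + 1) = false & dyadic (i + 2) = false].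
Proof.
move=> i_gt2 Di; split; apply/negP=> Dj.
- by have := dyadic_gap Dj Di; lia.
- by have := dyadic_gap Di Dj; lia.
by have := dyadic_gap Di Dj; lia.
Qed.

Lemma full_le1 i : full i <= 1.
Proof. by rewrite /full; case: (dyadic _); case: (_ == _). Qed.

Lemma raw_ub M i : raw M i < q.
Proof.
have dig := digit_ub M (offset i) (lg q - 1 + full i).
have: 2 ^ (lg q - 1 + full i) <= q.
  by rewrite {2}q_pow2 leq_exp2l //; have := full_le1 i; lia.
rewrite /raw /live; case: (i < n); last by lia.
case: (i =P 3) => [->|_] /=; first by lia.
by case: (4 < i); case: (dyadic i); lia.
Qed.

Lemma raw_half M i : i != 3 -> full i = 0 -> 2 * raw M i < q.
Proof.
move=> i_neq3 half; have dig := digit_ub M (offset i) (lg q - 1 + full i).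
have: 2 ^ (lg q - 1 + full i) * 2 = q.
  by rewrite {2}q_pow2 half addn0 -expnSr; congr (_ ^ _); lia.
rewrite /raw /live (negbTE i_neq3); case: (i < n); last by lia.
by case: (4 < i); case: (dyadic i); lia.
Qed.

Lemma raw3 M : raw M 3 = q - 2.
Proof. by rewrite /raw /live (ltn_trans _ n_ge6) //= mul0n addn0 !mul1n. Qed.

(** A halved symbol has [x + 1 <= q / 2 < q - 1], which leaves [q - 1] free as a substitute when
    [x + 1] is forbidden. *)
Lemma avoidP M i : 2 < i -> dyadic (i + 1) ->
  let u := avoid (raw M i) (raw M (i + 2)) in
  [/\ 0 < u, u < q & u != raw M (i + 2) + 1].
Proof.
move=> i_gt2 Di /=; rewrite /avoid.
have [i_eq3|i_neq3] := eqVneq i 3.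
  (* Position 3 holds the large value [q - 2]; here it is the right neighbour at 5 that is
     halved. *)
  have r5 : 2 * raw M (3 + 2) < q by apply: raw_half; rewrite // /full muln0.
  by rewrite i_eq3 /= raw3; case: eqP; split; lia.
have := @raw_half M i i_neq3; rewrite {1}/full Di => /(_ erefl) xq.
by case: eqP; split; lia.
Qed.

Lemma base_small M i : i < 3 -> base M i = 0.
Proof. by rewrite /base => ->. Qed.

Lemma base3 M : base M 3 = q - 1.
Proof.
rewrite /base /= dyadic_lt8 //= dyadic4 /avoid.
have r5 : 2 * raw M (3 + 2) < q by apply: raw_half; rewrite // /full muln0.
rewrite raw3.
by case: eqP; lia.
Qed.

Lemma base_dyadic M i : 2 < i -> dyadic i ->
  [/\ base M (i - 1) = base M i, base M (i + 1) = raw M (i + 1),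
      0 < base M i, base M i < q & base M i != base M (i + 1) + 1].
Proof.
move=> i_gt2 Di; have [D1 D2 D3] := dyadic_next i_gt2 Di.
have i_gt3 : 3 < i by case: (i =P 3) Di => [->|]; [rewrite dyadic_lt8|lia].
have E : base M i = avoid (raw M (i - 1)) (raw M (i - 1 + 2)).
  rewrite /base Di (leq_gtF i_gt2) /=; congr (avoid _ (raw _ _)); lia.
have E1 : base M (i + 1) = raw M (i + 1).
  by rewrite /base D2 -addnA D3; case: ltnP => //; lia.
have [] := @avoidP M (i - 1); rewrite -?E ?subnK; try lia; move=> // *; split=> //.
- rewrite {1}/base D1 subnK ?Di; last by lia.
  by rewrite -E; case: ltnP => //; lia.
- by rewrite E1; have -> : i + 1 = i - 1 + 2 by lia.
Qed.

Lemma base_ub M i : base M i < q.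
Proof.
case: (ltnP i 3) => [/base_small -> | i_ge3]; first by lia.
case Di: (dyadic i); first by case: (base_dyadic M i_ge3 Di).
case Di1: (dyadic (i + 1)).
  rewrite /base (leq_gtF i_ge3) Di Di1 /=.
  by case: (avoidP M i_ge3 Di1).
by rewrite /base (leq_gtF i_ge3) Di Di1 /= raw_ub.
Qed.

(** A descent forces a positive symbol, and two descents force a sum of at least 3; smaller values
    of [c] are therefore realised as [q + c]. The triple starting with [q - 1], 2 needs [q >= 4]. *)
Lemma head3P e1 e2 c : e1 < 2 -> e2 < 2 -> c < q ->
  let s := head3 e1 e2 c in
  [/\ (nth 0 s 0 <= nth 0 s 1) + e1 = 1, (nth 0 s 1 <= nth 0 s 2) + e2 = 1,
      forall i, nth 0 s i < q
    & nth 0 s 0 + nth 0 s 1 + nth 0 s 2 = c %[mod q]].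
Proof.
have pick (x y z : nat) : x < q -> y < q -> z < q ->
    forall i, nth 0 [:: x; y; z] i < q.
  by move=> xq yq zq [|[|[|i]]] //=; rewrite nth_nil; lia.
rewrite /head3; case: e1 => [|[|//]] _; case: e2 => [|[|//]] _ c_lt /=.
- by split=> //; apply: pick => //; lia.
- case: eqP => c0 /=; split; try by [lia|apply: pick; lia].
    by rewrite c0 (_ : _ + _ = q) ?modnn ?mod0n //; lia.
  by congr (_ %% _); lia.
- case: eqP => c0 /=; split; try by [lia|apply: pick; lia].
    by rewrite c0 (_ : _ + _ = q) ?modnn ?mod0n //; lia.
  by congr (_ %% _); lia.
case: eqP => c0 /=; last case: ltnP => c3 /=.
- split; try by [lia|apply: pick; lia].
  by rewrite c0 (_ : _ + _ = q) ?modnn ?mod0n //; lia.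
- split; try by [lia|apply: pick; lia].
  by rewrite (_ : _ + _ = q + c) ?modnDl //; lia.
split; try by [lia|apply: pick; lia].
by congr (_ %% _); lia.
Qed.

(** * Syndrome and symbol sum of the codeword *)

Lemma flip_le1 d i : flip d i <= 1.
Proof.
by rewrite /flip; have := ltn_pmod (d %/ i) (isT : 0 < 2); case: (dyadic i); lia.
Qed.

Lemma deficit_ub a b M : deficit a b M < q.
Proof. by rewrite ltn_pmod //; lia. Qed.

Lemma word_ub a b M i : word a b M i < q.
Proof.
rewrite /word; case: ifP => _; last first.
  by rewrite /tail; have := base_ub M i; lia.
by have [] := head3P (ltn_pmod (defect a M) (isT : 0 < 2))
  (ltn_pmod (defect a M %/ 2) (isT : 0 < 2)) (deficit_ub a b M).
Qed.

Lemma word_not_dyadic a b M i : 2 < i -> dyadic i = false ->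
  word a b M i = base M i.
Proof.
by move=> i_gt2 Di; rewrite /word (leq_gtF i_gt2) /tail /flip Di subn0.
Qed.

Lemma word_dyadic a b M i : 2 < i ->
  word a b M i = base M i - flip (defect a M) i.
Proof. by move=> i_gt2; rewrite /word (leq_gtF i_gt2). Qed.

(* Lowering [s_(2^j)] by one clears the ascent at [2^j]; the ascent at [2^j + 1]
   does not move, since the left neighbour is never [s_(2^j + 1) + 1]. *)
Lemma ascent_word a b M i : 0 < i ->
  (base M (i - 1) <= base M i) =
  (word a b M (i - 1) <= word a b M i) + flip (defect a M) i :> nat.
Proof.
set d := defect a M.
have [h1 h2 h3 _] := head3P (ltn_pmod d (isT : 0 < 2))
  (ltn_pmod (d %/ 2) (isT : 0 < 2)) (deficit_ub a b M).
case: i => [//|[|[|[|i]]]] _.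
- by rewrite !base_small // /word /flip dyadic1 divn1 mul1n h1.
- by rewrite !base_small // /word /flip dyadic2 mul1n h2.
- rewrite (@word_not_dyadic a b M 3) ?dyadic_lt8 // base_small // base3.
  rewrite /flip dyadic_lt8 // mul0n addn0 /word /=.
  by have := h3 (3 - 1); rewrite -/d; case: leqP => //; lia.
set j := i.+4; have j_gt3 : 3 < j by [].
have f_le1 := flip_le1 d; rewrite !word_dyadic; try lia.
(* In the base word this symbol equals its left neighbour, which is not lowered. Being positive, it
   really drops when lowered, and equality becomes a descent. *)
case Dj: (dyadic j).
  have [e1 _ u_gt0 _ _] := base_dyadic M (ltnW j_gt3) Dj.
  have [D1 _ _] := dyadic_next (ltnW j_gt3) Dj.
  rewrite e1 -/d {1 2}/flip D1 mul0n subn0 leqnn.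
  by have := f_le1 j; rewrite /flip Dj; lia.
rewrite -/d /(flip d j) Dj mul0n subn0 addn0.
case Dj1: (dyadic (j - 1)); last by rewrite /flip Dj1 mul0n subn0.
have [_ _ u_gt0 _] := @base_dyadic M (j - 1) ltac:(lia) Dj1.
rewrite subnK => [u_neq|]; last by lia.
by have := f_le1 (j - 1); case: (flip d (j - 1)) => [|[|//]]; lia.
Qed.

Lemma ascents_word a b M :
  ascents (base M) n = ascents (word a b M) n + defect a M.
Proof.
have <- : \sum_(i < n) i * flip (defect a M) i = defect a M.
  (* The defect is below [n], hence below [2 ^ up_log 2 n], so its binary expansion uses only powers
     of two below [n]. *)
  rewrite -[RHS](@modn_small _ (2 ^ up_log 2 n)); last first.
    apply: leq_trans (up_logP n (isT : 1 < 2)).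
    by rewrite ltn_pmod //; lia.
  by rewrite -sum_pow2_digits; apply: eq_bigr => i _; rewrite /flip /dyadic ltn_ord.
rewrite -big_split; apply: eq_bigr => -[[|i] lt_i] _ //=.
by rewrite (ascent_word a b) // mulnDr.
Qed.

Lemma ascents_word_mod a b M : a < n -> ascents (word a b M) n %% n = a.
Proof.
move=> a_lt; have := ascents_word a b M.
set A := ascents (base M) n; set X := ascents _ n => eqA.
have := divn_eq (A + n - a) n; rewrite -/(defect a M).
move: (_ %/ n) (defect a M) eqA => k d eqA eqd.
by rewrite -(modnDr X) (_ : X + n = k * n + a) ?modnMDl ?modn_small //; lia.
Qed.

Lemma sum_word a b M : b < q -> (\sum_(i < n) word a b M i) %% q = b.
Proof.
move=> b_lt; have [_ _ _] := head3P (ltn_pmod (defect a M) (isT : 0 < 2))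
  (ltn_pmod (defect a M %/ 2) (isT : 0 < 2)) (deficit_ub a b M).
set h := head3 _ _ _ => sum_h.
have tail0 i : i < 3 -> tail a M i = 0 by move=> lt_i; rewrite /tail base_small.
have -> : \sum_(i < n) word a b M i =
          nth 0 h 0 + nth 0 h 1 + nth 0 h 2 + \sum_(i < n) tail a M i.
  rewrite -(big_mkord predT (word a b M)) -(big_mkord predT (tail a M)).
  rewrite !(@big_cat_nat _ _ _ 3 0 n) //=; try lia.
  rewrite [in RHS]big_nat_cond [in RHS]big1 ?add0n; last first.
    by move=> i /andP[/andP[_ /tail0]].
  rewrite big_nat_recr //= big_nat_recr //= big_nat1; congr (_ + _).
  by apply: eq_big_nat => i /andP[i_ge3 _]; rewrite word_dyadic.
rewrite -modnDml sum_h modnDml /deficit modnDml.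
set T := \sum_(i < n) _; rewrite (_ : b + _ + T = T * q + b); last first.
  by have /subnKC eq_q : 1 <= q by [lia]; rewrite -{2}eq_q; lia.
by rewrite modnMDl modn_small.
Qed.

(** * Recovering the message from the unreserved symbols *)

Lemma avoid_inj x y w : 2 * x < q -> 2 * y < q -> avoid x w = avoid y w -> x = y.
Proof. by rewrite /avoid; case: eqP; case: eqP; lia. Qed.

Lemma raw_base M i : 2 < i -> dyadic i = false -> dyadic (i + 1) = false ->
  raw M i = base M i.
Proof. by rewrite /base => /leq_gtF -> -> ->. Qed.

Lemma raw_out M i : n <= i -> raw M i = 0.
Proof. by rewrite /raw => /leq_gtF ->. Qed.

Lemma raw_dead M i : i != 3 -> live i = 0 -> raw M i = 0.
Proof. by rewrite /raw => /negbTE -> ->; rewrite muln0. Qed.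

Lemma base_inj M M' :
    (forall i, i < n -> 2 < i -> dyadic i = false -> base M i = base M' i) ->
  forall i, raw M i = raw M' i.
Proof.
move=> eq_base i; case: (ltnP i n) => [i_lt | ?]; last by rewrite !raw_out.
have [->|i_neq3] := eqVneq i 3; first by rewrite !raw3.
case: (ltnP 4 i) => [i_gt4 | ?]; last by rewrite !raw_dead // /live ltnNge; lia.
case Di: (dyadic i); first by rewrite !raw_dead // /live Di muln0.
case Di1: (dyadic (i + 1)); last first.
  by rewrite !raw_base ?eq_base //; lia.
have [_ D2 D3] := @dyadic_next (i + 1) ltac:(lia) Di1.
(* The symbol right of the power of two is stored raw and is recovered first; [avoid] is then
   inverted for a fixed second argument. Beyond the end both readings are 0. *)
have eq_w : raw M (i + 2) = raw M' (i + 2).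
  case: (ltnP (i + 2) n) => [lt2 | ?]; last by rewrite !raw_out.
  have E1 : i + 1 + 1 = i + 2 by lia.
  have E2 : i + 1 + 2 = i + 2 + 1 by lia.
  by rewrite !raw_base ?eq_base -?E2 -?E1 //; lia.
have i_gt2 : 2 < i by lia.
have := eq_base i i_lt i_gt2 Di.
rewrite /base (leq_gtF i_gt2) Di Di1 eq_w.
by apply: avoid_inj; apply: raw_half; rewrite // /full Di1.
Qed.

(** Bits are consumed consecutively: position [k] fixes those from [offset k] up to [offset k.+1],
    and the induction fixes the earlier ones. *)
Lemma raw_inj M M' : (forall i, raw M i = raw M' i) ->
  forall k, k <= n -> forall r, r < offset k -> nth false M r = nth false M' r.
Proof.
move=> eq_raw; elim=> [|k IH] lt_k r; first by rewrite /offset big_ord0.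
rewrite /offset big_ord_recr /= -/(offset k) => lt_r.
case: (ltnP r (offset k)) => [|le_r]; first exact: IH (ltnW lt_k) r.
have := eq_raw k; rewrite /raw lt_k; move: lt_r; rewrite /width /live.
case: (ltnP 4 k) => [k_gt4 | _]; last by rewrite mul0n addn0 ltnNge le_r.
case: (dyadic k); first by rewrite muln0 addn0 ltnNge le_r.
rewrite subn0 !mul1n => lt_r /addnI /digit_inj; apply.
by rewrite le_r.
Qed.

(** * Counting the message bits *)

Lemma sum_dyadic : \sum_(i < n) dyadic i = clg n.
Proof.
by rewrite -[clg n]sum_pow2; apply: eq_bigr => i _; rewrite /dyadic ltn_ord.
Qed.

(** Each position from 5 on is worth [lg q] bits, up to losses: all of them at a power of two, one
    at each left neighbour, one at position 5. *)
Lemma offset_msg_len : offset n = msg_len q n.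
Proof.
have [t_ge3 t_le] := up_log2_bound n_ge6.
have sumD : \sum_(5 <= i < n) dyadic i = clg n - 3.
  rewrite -sum_dyadic -(big_mkord predT (fun i => dyadic i : nat)).
  rewrite (@big_cat_nat _ _ _ 5 0 n) //=; last by lia.
  by rewrite unlock /= !dyadic_lt8 //=; lia.
(* Shifting the range by one drops 5 and adds [n], neither of which is dyadic. *)
have sumD1 : \sum_(5 <= i < n) dyadic (i + 1) = clg n - 3.
  have dn : dyadic n = false by rewrite /dyadic ltnn.
  have := @big_nat_recl _ 0 addn n 5 (fun i => dyadic i : nat) (ltnW n_ge6).
  rewrite big_nat_recr ?(ltnW n_ge6) //= dn dyadic_lt8 //= addn0 add0n sumD => ->.
  by apply: eq_bigr => i _; rewrite addn1.
have sum5 : \sum_(5 <= i < n) (i == 5) = 1.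
  rewrite big_ltn // big_nat_cond big1 // => i /andP[/andP[i_gt5 _] _].
  by case: eqP i_gt5 => // ->.
have offsetE : offset n = \sum_(5 <= i < n) width i.
  rewrite /offset -(big_mkord predT width) (@big_cat_nat _ _ _ 5 0 n) //=; last by lia.
  rewrite big_nat_cond big1 // => i /andP[/andP[_ i_lt] _].
  by rewrite /width /live leq_gtF.
(* The losses are added back. No position suffers two of them, since 5 is neither dyadic nor the
   left neighbour of a power of two. *)
have : \sum_(5 <= i < n)
    (width i + lg q * dyadic i + dyadic (i + 1) + (i == 5)) = lg q * (n - 5).
  rewrite mulnC -sum_nat_const_nat; apply: eq_big_nat => i /andP[i_ge5 _].
  rewrite /width /live /full i_ge5.
  case Di: (dyadic i).
    have [_ -> _] := @dyadic_next i (ltnW (ltnW i_ge5)) Di.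
    by case: eqP Di => [->|_ _]; [rewrite dyadic_lt8 | lia].
  by case: (i =P 5) => [->|_];
    [rewrite (@dyadic_lt8 (5 + 1)) //= | case: (dyadic _)]; lia.
rewrite !big_split /= -big_distrr /= sumD sumD1 sum5 -offsetE /msg_len.
move: lg_ge2 n_ge6 t_ge3 t_le; rewrite -/(clg n).
move: (lg q) (clg n) (offset n) => m t o; nia.
Qed.

Lemma base_msg_inj M M' : size M = msg_len q n -> size M' = msg_len q n ->
    (forall i, i < n -> 2 < i -> dyadic i = false -> base M i = base M' i) ->
  M = M'.
Proof.
move=> szM szM' /base_inj/raw_inj/(_ n (leqnn n)) eqM.
apply: (@eq_from_nth _ false) => [|r]; rewrite szM ?szM' // -offset_msg_len.
exact: eqM.
Qed.

End Codeword.

(** * The encoder: membership in the code and systematicity *)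

Definition encode (q n : nat) : encoders q n :=
  fun a b M => [tuple inZp (word q n a b M i) | i < n].

Section Encoder.

Variables q n : nat.
Hypotheses (q_ge4 : 4 <= q) (q_pow2 : q = 2 ^ lg q) (n_ge6 : 6 <= n).

Let q_gt1 : 1 < q.
Proof. exact: leq_trans q_ge4. Qed.

Lemma ltn_Zq (x : 'Z_q) : x < q.
Proof. by rewrite -{2}(Zp_cast q_gt1). Qed.

Lemma inZpK x : x < q -> (inZp x : 'Z_q) = x :> nat.
Proof. by move=> lt_x; rewrite /= (Zp_cast q_gt1) modn_small. Qed.

Lemma nth_encode (a : 'I_n) (b : 'Z_q) M i : i < n ->
  nth 0%R (encode a b M) i = word q n a b M i :> nat.
Proof.
move=> lt_i; rewrite -[i]/(val (Ordinal lt_i)) -tnth_nth tnth_mktuple.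
by rewrite inZpK // word_ub.
Qed.

Lemma encode_VT (a : 'I_n) (b : 'Z_q) M : encode a b M \in VT a b.
Proof.
rewrite inE; apply/andP; split; apply/eqP.
  rewrite /syn -[RHS](ascents_word_mod q_ge4 q_pow2 n_ge6 b M (ltn_ord a)).
  rewrite /ascents -(big_mkord predT
    (fun i => i * (word q n a b M (i - 1) <= word q n a b M i))).
  rewrite [in RHS]big_ltn ?(ltn_trans _ n_ge6) // mul0n add0n.
  congr (_ %% n); apply: eq_big_nat => i /andP[i_gt0 i_lt].
  by rewrite /alpha !nth_encode ?subn1 //; lia.
apply: val_inj; rewrite /modsum /=.
have -> : (\sum_(i < n) tnth (encode a b M) i)%R =
          inZp (\sum_(i < n) word q n a b M i) :> 'Z_q.
  rewrite -Zp_nat natr_sum; apply: eq_bigr => i _.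
  by rewrite tnth_mktuple Zp_nat.
by rewrite /= [X in _ %% X](Zp_cast q_gt1) sum_word // ltn_Zq.
Qed.

(** Only the powers of two and the first three positions depend on [a] and [b]; elsewhere the base
    word is visible. *)
Lemma encode_systematic : systematic (@encode q n).
Proof.
pose P := [set i : 'I_n | (2 < i) && ~~ dyadic n i].
pose f (M : (msg_len q n).-tuple bool) : {ffun {i : 'I_n | i \in P} -> 'Z_q} :=
  [ffun i => inZp (base q n M (val (val i)))].
exists P, f; split=> [M M' eq_f | a b M].
  apply/val_inj/(base_msg_inj q_ge4 q_pow2 n_ge6); rewrite ?size_tuple //.
  move=> i i_lt i_gt2 Di.
  have iP : Ordinal i_lt \in P by rewrite inE /= i_gt2 Di.
  pose x : {i : 'I_n | i \in P} := exist (fun i => i \in P) (Ordinal i_lt) iP.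
  move/ffunP/(_ x)/(congr1 (@nat_of_ord _)): eq_f.
  by rewrite !ffunE !inZpK // base_ub.
apply/ffunP=> -[i iP]; rewrite !ffunE /= tnth_mktuple.
by move: iP; rewrite inE => /andP[i_gt2 /negbTE Di]; rewrite word_not_dyadic.
Qed.

End Encoder.

Lemma msg_lenE q n : 4 <= q -> q = 2 ^ lg q -> 6 <= n ->
  msg_len q n + clg n * (lg q + 1) + 2 * (lg q - 1) = n * lg q.
Proof.
move=> q_ge4 q_pow2 /up_log2_bound; rewrite -/(clg n) /msg_len.
have : 2 <= lg q by rewrite -(@leq_exp2l 2) // -q_pow2.
by move: (lg q) (clg n) => m t; nia.
Qed.

(** * Running programs *)

Fixpoint expr_lits (e : expr) : nat :=
  match e with
  | Lit c => c
  | Reg _ => 0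
  | Get _ e1 => expr_lits e1
  | Bin _ e1 e2 => maxn (expr_lits e1) (expr_lits e2)
  end.

Fixpoint lits (c : cmd) : nat :=
  match c with
  | Skip => 0
  | Assign _ e => expr_lits e
  | Put _ e1 e2 => maxn (expr_lits e1) (expr_lits e2)
  | Seq c1 c2 => maxn (lits c1) (lits c2)
  | If e c1 c2 => maxn (expr_lits e) (maxn (lits c1) (lits c2))
  | While e c1 => maxn (expr_lits e) (lits c1)
  end.

(* For a loop this is the cost of one iteration. *)
Fixpoint pass_cost (c : cmd) : nat :=
  match c with
  | Skip => 1
  | Assign _ e => (cost e).+1
  | Put _ e1 e2 => (cost e1 + cost e2).+1
  | Seq c1 c2 => pass_cost c1 + pass_cost c2
  | If e c1 c2 => (cost e + (pass_cost c1 + pass_cost c2)).+1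
  | While e c1 => (cost e + pass_cost c1).+1
  end.

(** Meant for loop-free code; the loop case is a dummy that [safe] excludes. *)
Fixpoint run (c : cmd) (s : state) : state :=
  match c with
  | Skip => s
  | Assign x e => set_reg s x (eval s e)
  | Put m e1 e2 => set_mem s m (eval s e1) (eval s e2)
  | Seq c1 c2 => run c2 (run c1 s)
  | If e c1 c2 => if eval s e == 0 then run c2 s else run c1 s
  | While _ _ => s
  end.

(** Only stored values are constrained; intermediate values and addresses are controlled by
    [eval_ub]. *)
Fixpoint safe (B : nat) (c : cmd) (s : state) : Prop :=
  match c with
  | Skip => True
  | Assign x e => eval s e <= B
  | Put m e1 e2 => eval s e2 <= B
  | Seq c1 c2 => safe B c1 s /\ safe B c2 (run c1 s)
  | If e c1 c2 => if eval s e == 0 then safe B c2 s else safe B c1 s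
  | While _ _ => False
  end.

Definition bounded (B : nat) (s : state) : Prop :=
  (forall x, reg s x <= B) /\ (forall m i, Defs.mem s m i <= B).

Lemma bounded_set_reg B s x v : bounded B s -> v <= B -> bounded B (set_reg s x v).
Proof. by case=> regB memB vB; split=> //= y; case: ifP. Qed.

Lemma bounded_set_mem B s m i v :
  bounded B s -> v <= B -> bounded B (set_mem s m i v).
Proof. by case=> regB memB vB; split=> //= m' j; case: ifP. Qed.

Section Execution.

Variables B K N : nat.
Hypothesis B_gt1 : 1 < B.

(** Every binary operation contributes one spare factor [B >= 2], which absorbs a sum:
    [X + Y <= 2 * (X * Y)] for positive bounds. *)
Lemma eval_ub s e : bounded B s -> expr_lits e <= B -> eval s e <= B ^ cost e.
Proof.
case=> regB memB; have B1 : B <= B ^ 1 by rewrite expn1.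
elim: e => [c|x|m e _|o e1 IH1 e2 IH2] /=.
- by rewrite expn1.
- by rewrite expn1.
- by move=> _; apply: leq_trans (memB _ _) _; rewrite -{1}(expn1 B) leq_exp2l.
rewrite geq_max => /andP[/IH1 {}IH1 /IH2 {}IH2].
have lt1 : 0 < B ^ cost e1 by rewrite expn_gt0; lia.
have lt2 : 0 < B ^ cost e2 by rewrite expn_gt0; lia.
rewrite expnS expnD; move: IH1 IH2 lt1 lt2.
move: (eval s e1) (eval s e2) (B ^ _) (B ^ _) => x y X Y leX leY X0 Y0.
have XY1 : X <= X * Y by rewrite leq_pmulr.
have XY2 : Y <= X * Y by rewrite leq_pmull.
have XY3 : 2 * (X * Y) <= B * (X * Y) by rewrite leq_mul2r B_gt1 orbT.
have := leq_mul leX leY; have := leq_div x y; have := leq_mod x y.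
by case: o => /=; try case: (_ <= _); try case: (_ == _); lia.
Qed.

Lemma eval_fits s e :
  bounded B s -> expr_lits e <= B -> cost e <= K -> fits (B ^ K) s e.
Proof.
move=> bs; elim: e => [c|x|m e IH|o e1 IH1 e2 IH2] el eK;
  apply/andP; (split; [by apply: leq_trans (eval_ub bs el) _; rewrite leq_exp2l|]) => //.
  by apply: IH => //; apply: ltnW.
move: el eK; rewrite /= geq_max => /andP[? ?] ?.
by apply/andP; split; [apply: IH1 | apply: IH2] => //; lia.
Qed.

Lemma run_exec c s : pass_cost c <= K -> lits c <= B -> bounded B s ->
    safe B c s ->
  bounded B (run c s) /\
  exists T, exec (B ^ K) c s T (run c s) /\ T <= pass_cost c.
Proof.
elim: c s => [|x e|m e1 e2|c1 IH1 c2 IH2|e c1 IH1 c2 IH2|e c IH] s //=.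
- by move=> _ _ bs _; split=> //; exists 1; split=> //; apply: ExecSkip.
- move=> cK cB bs sB; split; first exact: bounded_set_reg.
  exists (cost e).+1; split=> //; apply: ExecAssign; apply: eval_fits => //.
  exact: ltnW.
- move=> cK; rewrite geq_max => /andP[l1 l2] bs sB.
  split; first exact: bounded_set_mem.
  exists (cost e1 + cost e2).+1; split=> //.
  by apply: ExecPut; apply: eval_fits => //; lia.
- move=> cK; rewrite geq_max => /andP[l1 l2] bs [s1 s2].
  have [|b1 [T1 [x1 t1]]] := IH1 s _ l1 bs s1; first by lia.
  have [|b2 [T2 [x2 t2]]] := IH2 _ _ l2 b1 s2; first by lia.
  split=> //; exists (T1 + T2); split; last exact: leq_add.
  exact: ExecSeq x1 x2.
move=> cK; rewrite !geq_max => /and3P[le l1 l2] bs.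
have fe : fits (B ^ K) s e by apply: eval_fits => //; lia.
case: eqP => [e0 | /eqP e_neq0] si.
  have [|b2 [T2 [x2 t2]]] := IH2 _ _ l2 bs si; first by lia.
  by split=> //; exists (cost e + T2).+1; split; [apply: ExecIfFalse | lia].
have [|b1 [T1 [x1 t1]]] := IH1 _ _ l1 bs si; first by lia.
by split=> //; exists (cost e + T1).+1; split; [apply: ExecIfTrue | lia].
Qed.

(** A Hoare-style triple with word size and running time. The factor [N.+1] pays for [N] rounds and
    the exit test of an unnested loop, and the bound is additive under [Seq]. *)
Definition leads (c : cmd) (s s' : state) : Prop :=
  pass_cost c <= K -> lits c <= B -> bounded B s ->
  bounded B s' /\
  exists T, exec (B ^ K) c s T s' /\ T <= N.+1 * pass_cost c.

Lemma leads_run c s : safe B c s -> leads c s (run c s).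
Proof.
move=> sc cK cB bs; have [br [T [x t]]] := run_exec cK cB bs sc.
by split=> //; exists T; split=> //; apply: leq_trans t _; rewrite leq_pmull.
Qed.

Lemma leads_seq c1 c2 s1 s2 s3 :
  leads c1 s1 s2 -> leads c2 s2 s3 -> leads (Seq c1 c2) s1 s3.
Proof.
rewrite /leads /= => L1 L2 cK; rewrite geq_max => /andP[l1 l2] b1.
have [|b2 [T1 [x1 t1]]] := L1 _ l1 b1; first by lia.
have [|b3 [T2 [x2 t2]]] := L2 _ l2 b2; first by lia.
split=> //; exists (T1 + T2); split; first exact: ExecSeq x1 x2.
by rewrite mulnDr leq_add.
Qed.

Lemma leads_while e c (st : nat -> state) :
    (forall k, k < N -> eval (st k) e != 0) -> eval (st N) e = 0 ->
    (forall k, k < N -> safe B c (st k) /\ run c (st k) = st k.+1) ->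
  leads (While e c) (st 0) (st N).
Proof.
rewrite /leads /= => goon stop step cK; rewrite geq_max => /andP[le lc] b0.
(* Induction on the number [j] of remaining rounds; the last summand is the failing test. *)
suff: forall j k, k + j = N -> bounded B (st k) -> bounded B (st N) /\
    exists T, exec (B ^ K) (While e c) (st k) T (st N) /\
      T <= j * (cost e + pass_cost c).+1 + (cost e).+1.
  case/(_ N 0 erefl b0) => bN [T [x t]]; split=> //; exists T; split=> //.
  by apply: leq_trans t _; rewrite mulSn addnC leq_add2r ltnS leq_addr.
have fe k : bounded B (st k) -> fits (B ^ K) (st k) e.
  by move=> bk; apply: eval_fits => //; lia.
elim=> [|j IH] k eq_k bk.
  move: bk (fe k); rewrite -[k]addn0 eq_k => bN /(_ bN) fN; split=> //.
  by exists (cost e).+1; split=> //; apply: ExecWhileFalse.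
have lt_k : k < N by lia.
have [sk rk] := step k lt_k.
have [|bk1 [T1 [x1 t1]]] := run_exec _ lc bk sk; first by lia.
rewrite rk in bk1 x1.
have [|bN [T2 [x2 t2]]] := IH k.+1 _ bk1; first by lia.
split=> //; exists (cost e + T1 + T2).+1; split; last by rewrite mulSn; lia.
by apply: (ExecWhileTrue (fe k bk) (goon k lt_k) x1 x2).
Qed.

End Execution.

(** Finite lists padded with zeros, so that updates of registers and arrays reduce by
    computation. *)
Definition mkst (r : seq nat) (m : seq (nat -> nat)) : state :=
  State (nth 0 r) (nth (fun=> 0) m).

Lemma set_reg_mkst r m x v : set_reg (mkst r m) x v = mkst (set_nth 0 r x v) m.
Proof.
congr State; apply: functional_extensionality => y.
by rewrite nth_set_nth.
Qed.

Lemma set_mem_mkst r m j i v :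
  set_mem (mkst r m) j i v =
  mkst r (set_nth (fun=> 0) m j
    (fun i' => if i' == i then v else nth (fun=> 0) m j i')).
Proof.
congr State; apply: functional_extensionality => j'.
apply: functional_extensionality => i'; rewrite nth_set_nth /=.
by case: (j' =P j) => [->|].
Qed.

(** * The encoding program *)

(** The loop invariant for an array: after [k] rounds its first [k] cells are filled and the others
    are still 0. *)
Definition upto (f : nat -> nat) (k i : nat) : nat := (i < k) * f i.

Lemma upto0 f : upto f 0 = fun=> 0.
Proof. by apply: functional_extensionality. Qed.

Lemma uptoS f k v :
  v = f k -> (fun i => if i == k then v else upto f k i) = upto f k.+1.
Proof.
move=> ->; apply: functional_extensionality => i; rewrite /upto ltnS.
by case: (ltngtP i k) => [||->]; rewrite ?mul1n.
Qed.

(* Registers: 0 = n, 1 = a, 2 = b, 3 = loop index, 4 = smallest power of two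
   not below the index, 5 = number of message bits read, 6 = ascent sum and then
   the defect, 7 = symbol sum and then the deficit.  Arrays: 0 = message,
   1 = codeword, 2 = dyadic flags, 3 = raw symbols, 4 = base word. *)

Definition for_loop (body : cmd) : cmd :=
  Seq (Assign 3 (Lit 0))
    (While (Bin Ltn (Reg 3) (Reg 0))
      (Seq body (Assign 3 (Bin Add (Reg 3) (Lit 1))))).

(** Register 4 doubles exactly when the index meets it, so no logarithm has to be computed. *)
Definition mark_dyadic : cmd :=
  Seq (Put 2 (Reg 3) (Bin Eqn (Reg 3) (Reg 4)))
      (Assign 4 (Bin Mul (Reg 4) (Bin Add (Lit 1) (Get 2 (Reg 3))))).

Definition full_expr : expr :=
  Bin Mul (Bin Defs.Sub (Lit 1) (Get 2 (Bin Add (Reg 3) (Lit 1))))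
          (Bin Defs.Sub (Lit 1) (Bin Eqn (Reg 3) (Lit 5))).

Definition live_expr : expr :=
  Bin Mul (Bin Ltn (Lit 4) (Reg 3)) (Bin Defs.Sub (Lit 1) (Get 2 (Reg 3))).

Definition bit_expr (r : nat) : expr := Get 0 (Bin Add (Reg 5) (Lit r)).

(** The sum is unrolled into the program text, whose length may depend on [q]. *)
Fixpoint digit_expr (l : nat) : expr :=
  if l is l'.+1
  then Bin Add (digit_expr l') (Bin Mul (Lit (2 ^ l')) (bit_expr l'))
  else Lit 0.

Definition read_symbol (q : nat) : cmd :=
  let h := lg q - 1 in
  Seq (Put 3 (Reg 3)
         (Bin Add (Bin Mul (Bin Eqn (Reg 3) (Lit 3)) (Lit (q - 2)))
            (Bin Mul live_expr
               (Bin Add (digit_expr h)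
                  (Bin Mul full_expr (Bin Mul (Lit (2 ^ h)) (bit_expr h)))))))
      (Assign 5 (Bin Add (Reg 5)
                   (Bin Mul live_expr (Bin Add (Lit h) full_expr)))).

Definition put_avoid (q : nat) (x w : expr) : cmd :=
  If (Bin Eqn x w) (Put 4 (Reg 3) (Lit (q - 1)))
                   (Put 4 (Reg 3) (Bin Add x (Lit 1))).

Definition make_base (q : nat) : cmd :=
  If (Bin Ltn (Reg 3) (Lit 3)) (Put 4 (Reg 3) (Lit 0))
    (If (Get 2 (Reg 3))
       (put_avoid q (Get 3 (Bin Defs.Sub (Reg 3) (Lit 1)))
                    (Get 3 (Bin Add (Reg 3) (Lit 1))))
       (If (Get 2 (Bin Add (Reg 3) (Lit 1)))
          (put_avoid q (Get 3 (Reg 3)) (Get 3 (Bin Add (Reg 3) (Lit 2))))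
          (Put 4 (Reg 3) (Get 3 (Reg 3))))).

Definition add_ascent : cmd :=
  Assign 6 (Bin Add (Reg 6)
              (Bin Mul (Reg 3)
                 (Bin Leq (Get 4 (Bin Defs.Sub (Reg 3) (Lit 1))) (Get 4 (Reg 3))))).

Definition set_defect : cmd :=
  Assign 6 (Bin Mod (Bin Defs.Sub (Bin Add (Reg 6) (Reg 0)) (Reg 1)) (Reg 0)).

(** Cells 0, 1, 2 receive 0 here and are overwritten by [put_head]. *)
Definition lower_symbol : cmd :=
  Seq (Put 1 (Reg 3)
         (Bin Defs.Sub (Get 4 (Reg 3))
            (Bin Mul (Get 2 (Reg 3))
               (Bin Mod (Bin Div (Reg 6) (Reg 3)) (Lit 2)))))
      (Assign 7 (Bin Add (Reg 7) (Get 1 (Reg 3)))).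

Definition set_deficit (q : nat) : cmd :=
  Assign 7 (Bin Mod (Bin Add (Reg 2) (Bin Mul (Lit (q - 1)) (Reg 7))) (Lit q)).

Definition put3 (x y z : expr) : cmd :=
  Seq (Put 1 (Lit 0) x) (Seq (Put 1 (Lit 1) y) (Put 1 (Lit 2) z)).

Definition put_head (q : nat) : cmd :=
  let c := Reg 7 in
  let c0 := Bin Eqn c (Lit 0) in
  let c1 := Bin Defs.Sub c (Lit 1) in
  let top := Lit (q - 1) in
  If (Bin Mod (Reg 6) (Lit 2))
    (If (Bin Mod (Bin Div (Reg 6) (Lit 2)) (Lit 2))
       (If c0 (put3 top (Lit 1) (Lit 0))
          (If (Bin Ltn c (Lit 3)) (put3 top (Lit 2) c1)
                                  (put3 c1 (Lit 1) (Lit 0))))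
       (If c0 (put3 top (Lit 0) (Lit 1)) (put3 c (Lit 0) (Lit 0))))
    (If (Bin Mod (Bin Div (Reg 6) (Lit 2)) (Lit 2))
       (If c0 (put3 (Lit 1) top (Lit 0)) (put3 (Lit 0) c (Lit 0)))
       (put3 (Lit 0) (Lit 0) c)).

Definition encoder_prog (q : nat) : cmd :=
  Seq (Assign 4 (Lit 1))
    (Seq (for_loop mark_dyadic)
      (Seq (for_loop (read_symbol q))
        (Seq (for_loop (make_base q))
          (Seq (for_loop add_ascent)
            (Seq set_defect
              (Seq (for_loop lower_symbol)
                (Seq (set_deficit q) (put_head q)))))))).

(** Offsets and symbol sums stay below [q * n] and ascent sums below [n * n]; all of them have to
    fit under a power of [n] whose exponent depends on [q] only. *)
Lemma leq_mul_expn q n : 1 < n -> q * n * n <= n ^ (q + 2).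
Proof.
move=> n_gt1; rewrite -mulnA expnD expnS expn1 leq_mul2r.
by rewrite (ltnW (ltn_expl q n_gt1)) orbT.
Qed.

(** * Correctness of the passes and of the whole program *)

Section Correctness.

Variables (q n K a b : nat) (M : seq bool).
Hypotheses (q_ge4 : 4 <= q) (q_pow2 : q = 2 ^ lg q) (n_ge6 : 6 <= n).
Hypotheses (a_lt : a < n) (b_lt : b < q).

Local Notation B := (n ^ (q + 2)).
Local Notation "s ~[ c ]~> t" := (leads B K n c s t) (at level 70).

Let B_ge : q * n * n <= B.
Proof. by apply: leq_mul_expn; apply: ltn_trans n_ge6. Qed.

Let leqB : q <= B.
Proof. by apply: leq_trans B_ge; rewrite -mulnA leq_pmulr // muln_gt0; lia. Qed.

Let lenB : n <= B.
Proof. by apply: leq_trans B_ge; rewrite leq_pmull // muln_gt0; lia. Qed.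

Let B_gt1 : 1 < B.
Proof. by apply: leq_trans lenB; apply: leq_trans n_ge6. Qed.

(** Here [rs k] and [ms k] are the other registers and the arrays before round [k]. The old index
    [i0] is arbitrary because the loop resets it. *)
Lemma leads_for body i0 rs ms :
    (forall k, k < n ->
      let s := mkst (n :: a :: b :: k :: rs k) (ms k) in
      safe B body s /\
      run body s = mkst (n :: a :: b :: k :: rs k.+1) (ms k.+1)) ->
  mkst (n :: a :: b :: i0 :: rs 0) (ms 0) ~[for_loop body]~>
  mkst (n :: a :: b :: n :: rs n) (ms n).
Proof.
move=> step; have geB := B_ge; apply: (@leads_seq _ _ _ B_gt1).
  exact: (@leads_run _ _ _ B_gt1).
rewrite /= set_reg_mkst /=.
apply: (@leads_while _ _ _ B_gt1 _ _
  (fun k => mkst (n :: a :: b :: k :: rs k) (ms k))) => /=.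
- by move=> k ->.
- by rewrite ltnn.
move=> k lt_k; have [sk rk] := step k lt_k; split; last first.
  by rewrite rk set_reg_mkst /= addn1.
by split=> //; rewrite rk /=; nia.
Qed.

Let msg := msg_bit M.
Let pow2n i : nat := pow2 i.
Let dyadicn i : nat := dyadic n i.
Local Notation none := (fun _ : nat => 0).

Lemma pow2_up_log_ub k : k < n -> 2 ^ up_log 2 k.+1 <= 2 * n.
Proof.
case: k => [|k] lt_k; first by rewrite up_log1; lia.
have := @up_log_gtn 2 k.+2 isT isT; have := @up_log_gt0 2 k.+2.
by case: (up_log 2 k.+2) => [//|l] _; rewrite expnS /=; lia.
Qed.

Lemma leads_mark_dyadic :
  mkst [:: n; a; b; 0; 2 ^ up_log 2 0; 0; 0; 0] [:: msg; none; none; none; none]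
  ~[for_loop mark_dyadic]~>
  mkst [:: n; a; b; n; 2 ^ up_log 2 n; 0; 0; 0]
       [:: msg; none; dyadicn; none; none].
Proof.
(* The cut-off in [dyadic] is the state of the flag array after [n] rounds: cell [n] is never
   written. *)
have -> : dyadicn = upto pow2n n.
  by apply: functional_extensionality => i; rewrite /upto mulnb.
rewrite -{2}(upto0 pow2n).
apply: (leads_for (rs := fun k => [:: 2 ^ up_log 2 k; 0; 0; 0])
   (ms := fun k => [:: msg; none; upto pow2n k; none; none])) => k lt_k /=.
have pk := pow2_up_log_ub lt_k; have := B_ge.
have eq_p : 2 ^ up_log 2 k * (1 + (k == 2 ^ up_log 2 k)) = 2 ^ up_log 2 k.+1.
  by rewrite up_logS expnD /pow2; case: (_ == _).
rewrite !set_mem_mkst !set_reg_mkst /= eqxx eq_p => geB.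
split; first by case: (_ == _); nia.
by rewrite uptoS.
Qed.

Lemma eval_digit s l : (forall r, Defs.mem s 0 r = msg r) ->
  eval s (digit_expr l) = digit M (reg s 5) l.
Proof.
by move=> mem0; elim: l => [|l IH]; rewrite /digit ?big_ord0 // big_ord_recr /= mem0 IH.
Qed.

(** Multiplying the optional top bit by [f] lets the program read symbols of both widths without
    branching. *)
Lemma digit_full p h f : f <= 1 ->
  digit M p h + f * (2 ^ h * msg (p + h)) = digit M p (h + f).
Proof. by case: f => [|[|//]] _; rewrite ?addn0 ?addn1 ?digitS ?mul1n. Qed.

Lemma offset_ub k : offset q n k <= k * q.
Proof.
have lg_lt : lg q < q by rewrite {2}q_pow2 ltn_expl.
elim: k => [|k IH]; rewrite /offset ?big_ord0 // big_ord_recr /= mulSn addnC.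
apply: leq_add => //; rewrite /width /live; have := full_le1 n k.
by case: (4 < k); case: (dyadic n k); lia.
Qed.

Lemma offsetS k : offset q n k + width q n k = offset q n k.+1.
Proof. by rewrite /offset big_ord_recr. Qed.

Lemma leads_read_symbol p :
  mkst [:: n; a; b; n; p; offset q n 0; 0; 0]
       [:: msg; none; dyadicn; none; none]
  ~[for_loop (read_symbol q)]~>
  mkst [:: n; a; b; n; p; offset q n n; 0; 0]
       [:: msg; none; dyadicn; upto (raw q n M) n; none].
Proof.
rewrite -{2}(upto0 (raw q n M)).
apply: (leads_for (rs := fun k => [:: p; offset q n k; 0; 0])
   (ms := fun k => [:: msg; none; dyadicn; upto (raw q n M) k; none])) => k lt_k.
rewrite /= !set_mem_mkst !set_reg_mkst /= eval_digit //= -/(full n k) -/(live n k).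
rewrite digit_full ?full_le1 // -/(width q n k) offsetS.
have -> : (k == 3) * (q - 2) + live n k * digit M (offset q n k) (lg q - 1 + full n k)
  = raw q n M k by rewrite /raw lt_k mul1n.
have := raw_ub q_ge4 q_pow2 n_ge6 M k; have := offset_ub k.+1; have := B_ge.
have le_qn : k.+1 * q <= q * n by rewrite mulnC leq_mul2l lt_k orbT.
rewrite uptoS // => geB off_le raw_lt; by do 2 split=> //; nia.
Qed.

Lemma leads_make_base p o :
  mkst [:: n; a; b; n; p; o; 0; 0]
       [:: msg; none; dyadicn; upto (raw q n M) n; none]
  ~[for_loop (make_base q)]~>
  mkst [:: n; a; b; n; p; o; 0; 0]
       [:: msg; none; dyadicn; raw q n M; upto (base q n M) n].
Proof.
(* Since [raw] vanishes from [n] on, reads at [k + 1] and [k + 2] need no range check. *)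
have -> : upto (raw q n M) n = raw q n M.
  apply: functional_extensionality => i; rewrite /upto.
  by case: ltnP => [|/raw_out ->]; rewrite ?mul1n.
rewrite -{2}(upto0 (base q n M)).
apply: (leads_for (rs := fun k => [:: p; o; 0; 0])
   (ms := fun k => [:: msg; none; dyadicn; raw q n M; upto (base q n M) k])) => k lt_k.
have := base_ub q_ge4 q_pow2 n_ge6 M k; have := B_ge.
have upd v : v = base q n M k ->
    set_mem (mkst [:: n; a; b; k; p; o; 0; 0]
      [:: msg; none; dyadicn; raw q n M; upto (base q n M) k]) 4 k v =
    mkst [:: n; a; b; k; p; o; 0; 0]
      [:: msg; none; dyadicn; raw q n M; upto (base q n M) k.+1].
  by move=> eq_v; rewrite set_mem_mkst /= uptoS.
(* Unfolding one side of this trivial equation records the value of [base] in every branch of the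
   program. *)
move=> geB; have : base q n M k = base q n M k by [].
rewrite {2}/base /= /dyadicn.
case: (k < 3) => /=; first by move=> ev ?; rewrite upd.
rewrite /avoid.
case: (dyadic n k) => /=.
  by case: (_ == _) => /= ev ?; rewrite upd //; split=> //; lia.
case: (dyadic n (k + 1)) => /=.
  by case: (_ == _) => /= ev ?; rewrite upd //; split=> //; lia.
by move=> ev ?; rewrite upd //; split=> //; lia.
Qed.

Lemma upto_lt f k i : i < k -> upto f k i = f i.
Proof. by rewrite /upto => ->; rewrite mul1n. Qed.

Lemma ascentsS x k : ascents x k.+1 = ascents x k + k * (x (k - 1) <= x k).
Proof. by rewrite /ascents big_ord_recr. Qed.

Lemma ascents_ub x k : ascents x k <= k * k.
Proof.
elim: k => [|k IH]; first by rewrite /ascents big_ord0.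
by rewrite ascentsS; have := leq_b1 (x (k - 1) <= x k); nia.
Qed.

Let X := raw q n M.
Let Y := base q n M.
Let T := tail q n a M.
Let d := defect q n a M.

Lemma leads_add_ascent p o :
  mkst [:: n; a; b; n; p; o; ascents Y 0; 0]
       [:: msg; none; dyadicn; X; upto Y n]
  ~[for_loop add_ascent]~>
  mkst [:: n; a; b; n; p; o; ascents Y n; 0]
       [:: msg; none; dyadicn; X; upto Y n].
Proof.
apply: (leads_for (rs := fun k => [:: p; o; ascents Y k; 0])
   (ms := fun k => [:: msg; none; dyadicn; X; upto Y n])) => k lt_k.
(* At [k = 0] the truncated index reads cell 0, harmless because that term has weight 0. *)
have lt_k1 : k - 1 < n by apply: leq_ltn_trans (leq_subr 1 k) lt_k.
rewrite /= !set_reg_mkst /= !upto_lt // -ascentsS.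
have geB := B_ge; split=> //; apply: leq_trans (ascents_ub _ _) _; nia.
Qed.

Lemma leads_set_defect p o :
  mkst [:: n; a; b; n; p; o; ascents Y n; 0]
       [:: msg; none; dyadicn; X; upto Y n]
  ~[set_defect]~>
  mkst [:: n; a; b; n; p; o; d; \sum_(i < 0) T i]
       [:: msg; none; dyadicn; X; upto Y n].
Proof.
have := @leads_run _ K n B_gt1 set_defect (mkst [:: n; a; b; n; p; o; ascents Y n; 0]
       [:: msg; none; dyadicn; X; upto Y n]).
rewrite /= !set_reg_mkst /= -/(defect q n a M) big_ord0; apply.
exact: leq_trans (ltnW (ltn_pmod _ (ltac:(lia) : 0 < n))) lenB.
Qed.

Lemma sum_tail_ub k : \sum_(i < k) T i <= k * q.
Proof.
rewrite -[k in k * q]card_ord -sum_nat_const; apply: leq_sum => i _.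
by have := base_ub q_ge4 q_pow2 n_ge6 M i; rewrite /T /tail; lia.
Qed.

Lemma leads_lower_symbol p o :
  mkst [:: n; a; b; n; p; o; d; \sum_(i < 0) T i]
       [:: msg; none; dyadicn; X; upto Y n]
  ~[for_loop lower_symbol]~>
  mkst [:: n; a; b; n; p; o; d; \sum_(i < n) T i]
       [:: msg; upto T n; dyadicn; X; upto Y n].
Proof.
rewrite -{1}(upto0 T).
apply: (leads_for (rs := fun k => [:: p; o; d; \sum_(i < k) T i])
   (ms := fun k => [:: msg; upto T k; dyadicn; X; upto Y n])) => k lt_k.
rewrite /= !set_mem_mkst !set_reg_mkst /= eqxx upto_lt //.
rewrite -/(flip n d k) -/(tail q n a M k) uptoS //.
have sumS : \sum_(i < k) T i + T k = \sum_(i < k.+1) T i by rewrite big_ord_recr.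
rewrite -/(T k) sumS; split=> //.
have le_qn : k.+1 * q <= q * n by rewrite mulnC leq_mul2l lt_k orbT.
by have geB := B_ge; have := sum_tail_ub k.+1; split; nia.
Qed.

Lemma leads_set_deficit p o :
  mkst [:: n; a; b; n; p; o; d; \sum_(i < n) T i]
       [:: msg; upto T n; dyadicn; X; upto Y n]
  ~[set_deficit q]~>
  mkst [:: n; a; b; n; p; o; d; deficit q n a b M]
       [:: msg; upto T n; dyadicn; X; upto Y n].
Proof.
have := @leads_run _ K n B_gt1 (set_deficit q)
  (mkst [:: n; a; b; n; p; o; d; \sum_(i < n) T i]
       [:: msg; upto T n; dyadicn; X; upto Y n]).
rewrite /= !set_reg_mkst /= -/(deficit q n a b M); apply.
have geB := B_ge; have := deficit_ub q_ge4 q_pow2 n_ge6 a b M.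
lia.
Qed.

Lemma run_put_head s : reg s 7 < q ->
  safe B (put_head q) s /\
  forall i, Defs.mem (run (put_head q) s) 1 i =
    if i < 3 then nth 0 (head3 q (reg s 6 %% 2) (reg s 6 %/ 2 %% 2) (reg s 7)) i
    else Defs.mem s 1 i.
Proof.
move=> c_lt; have geB := B_ge.
rewrite /head3 /=.
case: (_ == 0); case: (_ == 0); try case: (reg s 7 == 0); try case: (reg s 7 < 3);
  by split=> [|[|[|[|i]]]] //=; lia.
Qed.

Lemma encoder_prog_exec :
  pass_cost (encoder_prog q) <= K -> lits (encoder_prog q) <= B ->
  exists t s, [/\ exec (B ^ K) (encoder_prog q) (input n a b M) t s,
    t <= n.+1 * pass_cost (encoder_prog q)
    & forall i, i < n -> Defs.mem s 1 i = word q n a b M i].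
Proof.
have geB := B_ge.
have -> : input n a b M =
    mkst [:: n; a; b; 0; 0; 0; 0; 0] [:: msg; none; none; none; none].
  congr State; apply: functional_extensionality.
    by case=> [|[|[|[|[|[|[|[|x]]]]]]]] //=; rewrite !nth_nil.
  case=> [|[|[|[|[|j]]]]] //=; apply: functional_extensionality => i.
  by rewrite !nth_nil.
move=> costK litsB.
(* The state just before the head is written. *)
set s7 := mkst [:: n; a; b; n; 2 ^ up_log 2 n; offset q n n; d; deficit q n a b M]
       [:: msg; upto T n; dyadicn; X; upto Y n].
have [safe7 out7] := @run_put_head s7 (deficit_ub q_ge4 q_pow2 n_ge6 a b M).
have L : mkst [:: n; a; b; 0; 0; 0; 0; 0] [:: msg; none; none; none; none]
    ~[encoder_prog q]~> run (put_head q) s7.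
  apply: (@leads_seq _ _ _ B_gt1).
    by apply: (@leads_run _ _ _ B_gt1) => /=; lia.
  rewrite /= set_reg_mkst /=.
  have e0 : [:: n; a; b; 0; 1; 0; 0; 0] = [:: n; a; b; 0; 2 ^ up_log 2 0; 0; 0; 0].
    by rewrite up_log0.
  rewrite e0; apply: (@leads_seq _ _ _ B_gt1); first exact: leads_mark_dyadic.
  have e1 : [:: n; a; b; n; 2 ^ up_log 2 n; 0; 0; 0] =
            [:: n; a; b; n; 2 ^ up_log 2 n; offset q n 0; 0; 0].
    by rewrite /offset big_ord0.
  rewrite e1; apply: (@leads_seq _ _ _ B_gt1); first exact: leads_read_symbol.
  apply: (@leads_seq _ _ _ B_gt1); first exact: leads_make_base.
  have e2 p o : [:: n; a; b; n; p; o; 0; 0] =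
                [:: n; a; b; n; p; o; ascents Y 0; 0].
    by rewrite /ascents big_ord0.
  rewrite e2; apply: (@leads_seq _ _ _ B_gt1); first exact: leads_add_ascent.
  apply: (@leads_seq _ _ _ B_gt1); first exact: leads_set_defect.
  apply: (@leads_seq _ _ _ B_gt1); first exact: leads_lower_symbol.
  apply: (@leads_seq _ _ _ B_gt1); first exact: leads_set_deficit.
  exact: (@leads_run _ _ _ B_gt1).
have [|_ [t [ex le_t]]] := L costK litsB.
  split=> [x | j i] /=.
    have bB : b <= B by lia.
    have aB : a <= B by lia.
    by case: x => [|[|[|[|[|[|[|[|x]]]]]]]] //=; rewrite nth_nil.
  case: j => [|[|[|[|[|j]]]]] //=; last by rewrite nth_nil.
  by rewrite /msg /msg_bit; case: nth; lia.
exists t, (run (put_head q) s7); split=> // i lt_i.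
by rewrite out7 /word; case: ifP => //= _; rewrite upto_lt.
Qed.

End Correctness.

(** * Literals of the program and the final assembly *)

Lemma lits_digit_expr l : expr_lits (digit_expr l) <= 2 ^ l.
Proof.
elim: l => [|l IH] //=; rewrite !geq_max expnS; have := ltn_expl l (isT : 1 < 2).
by move=> ?; apply/and3P; split; lia.
Qed.

Lemma lits_encoder_prog q : 4 <= q -> q = 2 ^ lg q -> lits (encoder_prog q) <= q + 5.
Proof.
move=> q_ge4 q_pow2.
have := lits_digit_expr (lg q - 1).
have : 2 ^ (lg q - 1) <= q by rewrite {2}q_pow2 leq_exp2l // leq_subr.
have : lg q <= q by rewrite {2}q_pow2 ltnW // ltn_expl.
move=> h1 h2 h3; have geq x y : x <= q + 5 -> y <= q + 5 -> maxn x y <= q + 5.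
  by rewrite geq_max => -> ->.
by rewrite /=; repeat apply: (geq); clear geq; lia.
Qed.

Theorem mainTheorem2 (q : nat) (hq4 : 4 <= q) (hq2 : exists m : nat, q = 2 ^ m) :
  exists E : forall n : nat, encoders q n,
    [/\ forall n : nat, 6 <= n ->
          (forall (a : 'I_n) (b : 'Z_q) (M : (msg_len q n).-tuple bool),
              E n a b M \in VT a b) /\
          systematic (E n),
        linear_time_computable 6 E
      & forall n : nat, 6 <= n ->
          ((msg_len q n)%:Z
             = n%:Z * (lg q)%:Z - (clg n)%:Z * ((lg q)%:Z + 1)
               - 2 * ((lg q)%:Z - 1))%R /\
          ((msg_len q n)%:Q / n%:Q
             = (lg q)%:Q - (clg n)%:Q * ((lg q)%:Q + 1) / n%:Q
               - (2 * (lg q)%:Q - 2) / n%:Q)%R].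
Proof.
have q_pow2 : q = 2 ^ lg q by case: hq2 => m ->; rewrite /lg trunc_expnK.
exists (@encode q); split.
- by move=> n n_ge6; split; [exact: encode_VT | exact: encode_systematic].
- pose p := encoder_prog q; pose K := pass_cost p.
  (* The word bound is [(n ^ (q + 2)) ^ K], and the time [(n + 1) * K] is at most [2 * K * n]. *)
  exists p, ((q + 2) * K), (2 * K) => n n_ge6 a b M.
  have [||t [s [ex le_t out]]] := @encoder_prog_exec q n K a b M hq4 q_pow2 n_ge6
    (ltn_ord a) (ltn_Zq hq4 b).
  + exact: leqnn.
  + apply: leq_trans (lits_encoder_prog hq4 q_pow2) _.
    have n_gt1 : 1 < n by apply: leq_trans n_ge6.
    apply: leq_trans (leq_mul_expn q n_gt1).
    have : q * (6 * 6) <= q * (n * n) by rewrite leq_mul2l leq_mul ?orbT.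
    by rewrite -mulnA; lia.
  exists t, s; split; first by rewrite expnM.
  + by apply: leq_trans le_t _; rewrite -/p -/K; nia.
  by move=> i; rewrite out // -nth_encode // -tnth_nth.
move=> n n_ge6; have := msg_lenE hq4 q_pow2 n_ge6.
have : 2 <= lg q by rewrite -(@leq_exp2l 2) // -q_pow2.
move: (msg_len q n) (clg n) (lg q) => k t m m_ge2 eq_k.
have eqZ : (k%:Z = n%:Z * m%:Z - t%:Z * (m%:Z + 1) - 2 * (m%:Z - 1))%R by lia.
split=> //; have n_neq0 : (n%:Q != 0 :> rat)%R by rewrite intr_eq0; lia.
rewrite eqZ !(rmorphB, rmorphM, rmorphD) /=.
by field.
Qed.
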